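(* Let $c\ge 1$ be the number of labels, $f$ a base multi-label classifier, $1\le k'\le c$, $1\le k\le c$, $\sigma>0$, and $\mathbf{x}\in\mathbb{R}^m$. Let $L(\mathbf{x})=\{a_1,\dots,a_d\}\subseteq\{1,\dots,c\}$ be a set of $d\ge1$ labels. Suppose we are given numbers $\underline{p_{i}}\in[0,1]$ for $i\in L(\mathbf{x})$ with $\underline{p_i}\le p_i$, and numbers $\overline{p}_j\in[0,1]$ for $j\in\{1,\dots,c\}\setminus L(\mathbf{x})$ with $p_j\le\overline{p}_j$. Index so that $\underline{p_{a_1}}\ge\cdots\ge\underline{p_{a_d}}$, and let $b_1,\dots,b_{c-d}$ be an enumeration of $\{1,\dots,c\}\setminus L(\mathbf{x})$ with $\overline{p}_{b_1}\ge\overline{p}_{b_2}\ge\cdots\ge\overline{p}_{b_{c-d}}$ (ties broken arbitrarily); by convention $\overline{p}_{b_l}:=0$ for $l>c-d$. For $e'\in\{1,\dots,\min\{d,k\}\}$ set $\eta=d-e'+1$, $s=k-e'+1$, $\underline{p_{A_u}}=\sum_{l=e'}^{e'+u-1}\underline{p_{a_l}}$ for $1\le u\le\eta$, and $\overline{p}_{B_v}=\sum_{l=s-v+1}^{s}\overline{p}_{b_l}$ for $1\le v\le s$, and assume $\overline{p}_{B_v}\le k'$ for all such $v$. Let $R\ge 0$ and let $e$ be the largest $e'\in\{1,\dots,\min\{d,k\}\}$ satisfying $$\max\Big\{\Phi\big(\Phi^{-1}(\underline{p_{a_{e'}}})-\tfrac{R}{\sigma}\big),\ \max_{u=1}^{\eta}\tfrac{k'}{u}\,\Phi\big(\Phi^{-1}(\tfrac{\underline{p_{A_u}}}{k'})-\tfrac{R}{\sigma}\big)\Big\}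 > \min\Big\{\Phi\big(\Phi^{-1}(\overline{p}_{b_s})+\tfrac{R}{\sigma}\big),\ \min_{v=1}^{s}\tfrac{k'}{v}\,\Phi\big(\Phi^{-1}(\tfrac{\overline{p}_{B_v}}{k'})+\tfrac{R}{\sigma}\big)\Big\},$$ or $e=0$ if no such $e'$ exists. Then for every perturbation $\delta\in\mathbb{R}^m$ with $\|\delta\|_2\le R$, $$|L(\mathbf{x})\cap g_k(\mathbf{x}+\delta)|\ge e .$$
   Context: A base multi-label classifier $f$ with parameter $k'$ assigns to every input $\mathbf{w}\in\mathbb{R}^m$ a set $f_{k'}(\mathbf{w})\subseteq\{1,\dots,c\}$ of exactly $k'$ labels (measurably in $\mathbf{w}$). Let $\epsilon\sim\mathcal{N}(0,\sigma^2 I)$ be isotropic Gaussian noise. The label probability of label $i$ at input $\mathbf{x}$ is $p_i=\Pr(i\in f_{k'}(\mathbf{x}+\epsilon))$; in general, for any input $\mathbf{z}$, write $p_i(\mathbf{z})=\Pr(i\in f_{k'}(\mathbf{z}+\epsilon))$, so $p_i=p_i(\mathbf{x})$. The smoothed multi-label classifier $g$ outputs $g_k(\mathbf{z})$, the set of $k$ labels with the largest values of $p_i(\mathbf{z})$ (ties broken arbitrarily). $\Phi$ is the standard normal CDF and $\Phi^{-1}$ its inverse, with conventions $\Phi^{-1}(0)=-\infty$, $\Phi^{-1}(1)=+\infty$, $\Phi(-\infty)=0$, $\Phi(+\infty)=1$. *)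

(* Defs.v *)
From HB Require Import structures.
From mathcomp Require Import all_boot all_order all_algebra.
From mathcomp Require Import all_classical all_reals all_analysis.
Set Implicit Arguments.
Unset Strict Implicit.
Unset Printing Implicit Defensive.
Import Order.TTheory GRing.Theory Num.Theory.
Local Open Scope classical_set_scope.
Local Open Scope ring_scope.

(* Vectors of R^m are m-tuples of reals (equipped in MathComp-Analysis with the
   product sigma-algebra generated by the coordinate projections). *)
Definition vadd (R : realType) (m : nat) (z w : m.-tuple R) : m.-tuple R :=
  [tuple tnth z i + tnth w i | i < m].

Definition norm2 (R : realType) (m : nat) (w : m.-tuple R) : R :=
  Num.sqrt (\sum_(i < m) tnth w i ^+ 2).

(* Expectation of h(eps) for eps ~ N(0, sigma^2 I_m), written as the iterated
   integral over the m independent N(0, sigma^2) coordinates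
   (normal_prob 0 sigma has standard deviation sigma). *)
Fixpoint gauss_exp (R : realType) (sigma : R) (m : nat) :
    (m.-tuple R -> \bar R) -> \bar R :=
  match m return (m.-tuple R -> \bar R) -> \bar R with
  | 0 => fun h => h [tuple]
  | m'.+1 => fun h =>
      (\int[normal_prob 0 sigma]_t gauss_exp sigma (fun u => h (cons_tuple t u)))%E
  end.

Definition gauss_prob (R : realType) (sigma : R) (m : nat)
    (E : m.-tuple R -> bool) : R :=
  fine (gauss_exp sigma (fun e => ((E e)%:R)%:E)).

Definition label_prob (R : realType) (sigma : R) (m c : nat)
    (f : m.-tuple R -> {set 'I_c}) (z : m.-tuple R) (i : 'I_c) : R :=
  gauss_prob sigma (fun e => i \in f (vadd z e)).

(* G is a possible output g_k(z) of the smoothed classifier: a set of k labels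
   with the largest values of p_i(z), ties broken arbitrarily. *)
Definition is_topk (R : realType) (c : nat) (p : 'I_c -> R) (k : nat)
  (G : {set 'I_c}) : Prop :=
  #|G| = k /\ (forall i j, i \in G -> j \notin G -> p j <= p i).

Definition Phi (R : realType) (x : R) : R :=
  fine (normal_prob 0 1 `]-oo, x]).
Definition PhiE (R : realType) (x : \bar R) : R :=
  match x with
  | r%:E => Phi r
  | +oo%E => 1
  | -oo%E => 0
  end.
Definition PhiInv (R : realType) (p : R) : \bar R :=
  if p <= 0 then -oo%E
  else if 1 <= p then +oo%E
  else (inf [set x : R | p <= Phi x])%:E.

Section certified.
Variables (R : realType) (sigma rad : R) (kp k d : nat).
(* pa l = lower bound of p_{a_l}, pb l = upper bound of p_{b_l} (1-indexed),
   with pb l = 0 for l > c - d. *)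
Variables (pa pb : nat -> R).

Definition pA (e' u : nat) : R := \sum_(e' <= l < e' + u) pa l.
Definition pB (e' v : nat) : R :=
  let s := (k - e').+1 in \sum_((s - v).+1 <= l < s.+1) pb l.

Definition cert_cond (e' : nat) : bool :=
  let eta := (d - e').+1 in
  let s := (k - e').+1 in
  let kr : R := kp%:R in
  \big[Num.max/PhiE (PhiInv (pa e') - (rad / sigma)%:E)%E]_(1 <= u < eta.+1)
      (kr / u%:R * PhiE (PhiInv (pA e' u / kr) - (rad / sigma)%:E)%E)
  >
  \big[Num.min/PhiE (PhiInv (pb s) + (rad / sigma)%:E)%E]_(1 <= v < s.+1)
      (kr / v%:R * PhiE (PhiInv (pB e' v / kr) + (rad / sigma)%:E)%E).

Definition cert_e : nat :=
  (\max_(1 <= e' < (minn d k).+1 | cert_cond e') e')%N.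
End certified.

(* Main.v *)
Require Import Defs.
From HB Require Import structures.
From mathcomp Require Import all_boot all_order all_algebra.
From mathcomp Require Import all_classical all_reals all_analysis.
From mathcomp Require Import zify measurable_realfun ring.
Set Implicit Arguments.
Unset Strict Implicit.
Unset Printing Implicit Defensive.
Import Order.TTheory GRing.Theory Num.Theory.
Import numFieldNormedType.Exports.
Local Open Scope classical_set_scope.
Local Open Scope ring_scope.

(** Write [E h] for the Gaussian mean of [h : R^m -> [0, 1]].  Translating by
    [d] amounts to reweighting by a likelihood ratio that is an increasing
    function of [<d, e>], so by the Neyman-Pearson argument a half-space
    orthogonal to [d] with the same mean as [h] extremises the mean after
    translation.  Since [<d, e>] is distributed as [|d| N(0, sigma^2)], the mean
    of a half-space moves from [Phi q] to [Phi (q +- |d| / sigma)].  This is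
    applied to [h w = #|S :&: f w| / k'] for a set [S] of labels, and to single
    labels.

    If fewer than [e'] labels of [L] are in [G], then at least [d - e' + 1]
    labels of [L] are outside [G] and at least [k - e' + 1] labels of [G] are
    outside [L].  In the order of the given bounds, the [l]-th of the former has
    a lower bound at least that of [a_(e' + l - 1)] and the [l]-th of the latter
    an upper bound at most that of [b_l].  The largest shifted probability of
    the former thus dominates the left-hand side of the certificate, the
    smallest of the latter is dominated by its right-hand side, and the first is
    at most the second because [G] consists of top labels. *)

(** * Change of variables for one-dimensional normal laws *)

Section normal_change_of_variables.
Context {R : realType}.
Local Notation mu := (@lebesgue_measure R).
Local Open Scope ereal_scope.
Implicit Types f : R -> \bar R.

(** The Radon-Nikodym derivative and [normal_pdf] have the same integral over every measurable set,
    hence agree almost everywhere. *)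
Lemma ge0_integral_normal_prob (m s : R) f :
  measurable_fun setT f -> (forall x, 0 <= f x) ->
  \int[normal_prob m s]_x f x = \int[mu]_x (f x * (normal_pdf m s x)%:E).
Proof.
move=> mf f0.
rewrite -(Radon_Nikodym_SigmaFinite.change_of_variables
  (normal_prob_dominates m s))//=.
have intRN := Radon_Nikodym_SigmaFinite.f_integrable (normal_prob_dominates m s).
have mpdf : measurable_fun setT (EFin \o normal_pdf m s).
  by apply/measurable_EFinP; exact: measurable_normal_pdf.
apply: ae_eq_integral => //.
- by apply: emeasurable_funM => //; exact: measurable_int intRN.
- exact: emeasurable_funM.
- apply: ae_eqe_mul2l => /=; apply: integral_ae_eq => //=.
  by move=> E _ mE; rewrite -Radon_Nikodym_SigmaFinite.f_integral//;
    exact: normal_prob_dominates.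
Qed.

(** Lebesgue measure and [|a|] times its image under [x -> a * x + b] agree on half-open intervals,
    hence on all measurable sets. A negative [a] reverses the preimage of an interval. *)
Lemma ge0_integral_affine (a b : R) f : a != 0%R ->
  measurable_fun setT f -> (forall x, 0 <= f x) ->
  \int[mu]_x f x = `|a|%:E * \int[mu]_x f (a * x + b)%R.
Proof.
move=> a0 mf f0.
pose phi : R -> measurableTypeR R := fun x => (a * x + b)%R.
have mphi : measurable_fun setT phi.
  by apply: measurable_funD => //; exact: measurable_funM.
have na0 : (0 <= `|a|)%R by [].
pose nu := [the measure _ _ of mscale (NngNum na0)
  (measure_function_pushforward__canonical__measure_function_Measure mu mphi)].
have itvE X : ocitv X -> mu X = nu X.
  move=> [[x y] _ <-].
  rewrite -[nu _]/(`|a|%:E * mu (phi @^-1` `]x, y])).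
  have [a_gt0|a_lt0|/eqP] := ltgtP 0%R a; last by rewrite eq_sym (negbTE a0).
  - have -> : phi @^-1` `]x, y] = `]((x - b) / a)%R, ((y - b) / a)%R]%classic.
      apply/seteqP; split => z; rewrite /phi/= !in_itv/= ltr_pdivrMr//
        ler_pdivlMr// ltrBlDr lerBrDr; by rewrite (mulrC z a).
    rewrite !lebesgue_measure_itv/= !lte_fin ltr_pM2r ?invr_gt0// ltrD2r.
    case: ifP => _; last by rewrite mule0.
    rewrite -!EFinB -EFinM gtr0_norm//; congr EFin; field; exact: a0.
  - have -> : phi @^-1` `]x, y] = `[((y - b) / a)%R, ((x - b) / a)%R[%classic.
      apply/seteqP; split => z; rewrite /phi/= !in_itv/= ltr_ndivlMr//
        ler_ndivrMr// ltrBlDr lerBrDr (mulrC z a); by move=> /andP[-> ->].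
    rewrite !lebesgue_measure_itv/= !lte_fin ltr_nM2r ?invr_lt0// ltrD2r.
    case: ifP => _; last by rewrite mule0.
    rewrite -!EFinB -EFinM ltr0_norm//; congr EFin; field; exact: a0.
rewrite (@eq_measure_integral _ _ _ _ nu); last first.
  by move=> A mA _; exact: (lebesgue_measure_unique itvE).
rewrite ge0_integral_mscale//= ge0_integral_pushforward//.
Qed.

(** One-dimensional Cameron-Martin formula: the exponential is the ratio of the densities of N(d,
    s^2) and N(0, s^2). *)
Lemma ge0_integral_normal_prob_shift (s d : R) f : s != 0%R ->
  measurable_fun setT f -> (forall x, 0 <= f x) ->
  \int[normal_prob 0 s]_x f (d + x)%R =
  \int[normal_prob 0 s]_x
    ((expR (d * x / s ^+ 2 - d ^+ 2 / (2 * s ^+ 2)))%:E * f x).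
Proof.
move=> s0 mf f0.
have mfd : measurable_fun setT (fun x : R => f (d + x)%R).
  by apply: measurableT_comp => //; exact: measurable_funD.
have mE : measurable_fun setT (fun x : R =>
   (expR (d * x / s ^+ 2 - d ^+ 2 / (2 * s ^+ 2)))%:E).
  apply/measurable_EFinP; apply: measurableT_comp => //.
  apply: measurable_funB => //; apply: measurable_funM => //.
have mpdf : measurable_fun setT (EFin \o normal_pdf 0 s).
  by apply/measurable_EFinP; exact: measurable_normal_pdf.
rewrite !ge0_integral_normal_prob//; last 2 first.
- exact: emeasurable_funM.
- by move=> x; rewrite mule_ge0// lee_fin expR_ge0.
rewrite [RHS](@ge0_integral_affine 1 d)//; first last.
- by move=> x; rewrite !mule_ge0// lee_fin ?expR_ge0 ?normal_pdf_ge0.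
- by apply: emeasurable_funM => //; exact: emeasurable_funM.
rewrite normr1 mul1e; apply: eq_integral => x _.
rewrite mul1r (addrC x d) (muleC (expR _)%:E) -muleA; congr (_ * _).
rewrite -EFinM; congr EFin.
rewrite !normal_pdfE// mulrCA; congr (_ * _)%R.
rewrite /normal_fun -expRD; congr expR.
field; exact: s0.
Qed.

Lemma ge0_integral_normal_prob_scale (s a : R) f : s != 0%R -> a != 0%R ->
  measurable_fun setT f -> (forall x, 0 <= f x) ->
  \int[normal_prob 0 s]_x f (a * x)%R = \int[normal_prob 0 (a * s)]_x f x.
Proof.
move=> s0 a0 mf f0.
have mpdf t : measurable_fun setT (EFin \o normal_pdf 0 t : R -> \bar R).
  by apply/measurable_EFinP; exact: measurable_normal_pdf.
have mfa : measurable_fun setT (fun x : R => f (a * x)%R).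
  by apply: measurableT_comp => //; exact: measurable_funM.
rewrite [LHS](ge0_integral_normal_prob 0 s mfa (fun=> f0 _)).
rewrite [RHS](ge0_integral_normal_prob 0 (a * s) mf f0).
rewrite [RHS](@ge0_integral_affine a 0)//; first last.
- by move=> x; rewrite mule_ge0// lee_fin normal_pdf_ge0.
- by apply: emeasurable_funM => //; exact: mpdf.
under [in RHS]eq_integral do rewrite addr0.
rewrite -ge0_integralZl//; first last.
- by move=> x _; rewrite mule_ge0// lee_fin normal_pdf_ge0.
- apply: emeasurable_funM => //; apply/measurable_EFinP.
  apply: measurableT_comp; first exact: measurable_normal_pdf.
  exact: measurable_funM.
apply: eq_integral => x _; rewrite muleCA; congr (_ * _).
rewrite -EFinM; congr EFin; rewrite !normal_pdfE ?mulf_neq0// mulrA.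
congr (_ * _)%R; last first.
  rewrite /normal_fun; congr expR; field; by rewrite s0 a0.
have peakE : ((a * s) ^+ 2 * pi *+ 2 = a ^+ 2 * (s ^+ 2 * pi *+ 2))%R by ring.
rewrite /normal_peak peakE sqrtrM ?sqr_ge0// sqrtr_sqr.
by rewrite invfM mulVKf// normr_eq0.
Qed.

(** Completing the square in [x]: the joint density of a summand [x] and the sum [z] is the density
    of the sum times the conditional density of [x] given [z]. *)
Lemma normal_pdf_conv (s1 s2 x z : R) : s1 != 0%R -> s2 != 0%R ->
  let c := Num.sqrt (s1 ^+ 2 + s2 ^+ 2) in
  (normal_pdf 0 s2 (z - x) * normal_pdf 0 s1 x =
   normal_pdf 0 c z * normal_pdf (z * s1 ^+ 2 / c ^+ 2) (s1 * s2 / c) x)%R.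
Proof.
move=> s10 s20 c.
have c2_gt0 : (0 < s1 ^+ 2 + s2 ^+ 2)%R.
  by rewrite ltr_pwDl ?sqr_ge0// exprn_even_gt0.
have c2E : (c ^+ 2 = s1 ^+ 2 + s2 ^+ 2)%R by rewrite sqr_sqrtr// ltW.
have c0 : c != 0%R by rewrite gt_eqF// sqrtr_gt0.
rewrite !normal_pdfE ?mulf_neq0 ?invr_eq0// mulrACA [RHS]mulrACA.
congr (_ * _)%R.
- rewrite /normal_peak -!invfM -!sqrtrM; first last.
  + by rewrite mulrn_wge0// mulr_ge0 ?sqr_ge0 ?pi_ge0.
  + by rewrite mulrn_wge0// mulr_ge0 ?sqr_ge0 ?pi_ge0.
  congr ((Num.sqrt _)^-1)%R; field; exact: c0.
- rewrite /normal_fun -!expRD; congr expR.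
  rewrite !exprMn exprVn c2E; field.
  by rewrite s20 s10 gt_eqF.
Qed.

Lemma measurable_integral_normal_probD (s : R) f :
  measurable_fun setT f -> (forall x, 0 <= f x) ->
  measurable_fun setT (fun x : R => \int[normal_prob 0 s]_y f (x + y)%R).
Proof.
move=> mf f0.
have mF : measurable_fun setT (fun p : R * R => f (p.1 + p.2)%R).
  by apply: measurableT_comp => //; exact: measurable_funD.
exact: (measurable_fun_fubini_tonelli_F
  (m2 := normal_prob 0 s) _ mF (fun=> f0 _)).
Qed.

Lemma ge0_integral_normal_prob_conv (s1 s2 : R) f : s1 != 0%R -> s2 != 0%R ->
  measurable_fun setT f -> (forall x, 0 <= f x) ->
  \int[normal_prob 0 s1]_x \int[normal_prob 0 s2]_y f (x + y)%R =
  \int[normal_prob 0 (Num.sqrt (s1 ^+ 2 + s2 ^+ 2))]_x f x.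
Proof.
move=> s10 s20 mf f0; set c := Num.sqrt _.
have mpdf m s : measurable_fun setT (EFin \o normal_pdf m s : R -> \bar R).
  by apply/measurable_EFinP; exact: measurable_normal_pdf.
(* Joint density in the variables [x] and [z = x + y], weighted by [f z]. After Tonelli the
   conditional density of [x] integrates to 1. *)
pose F (p : R * R) :=
  f p.2 * (normal_pdf 0 s2 (p.2 - p.1))%:E * (normal_pdf 0 s1 p.1)%:E.
have F0 p : 0 <= F p by rewrite !mule_ge0// lee_fin normal_pdf_ge0.
have mF : measurable_fun setT F.
  apply: emeasurable_funM; first apply: emeasurable_funM.
  - exact: measurableT_comp.
  - apply/measurable_EFinP; apply: measurableT_comp.
      exact: measurable_normal_pdf.
    exact: measurable_funB.
  - apply/measurable_EFinP; apply: measurableT_comp => //.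
    exact: measurable_normal_pdf.
have innerE x : \int[normal_prob 0 s2]_y f (x + y)%R * (normal_pdf 0 s1 x)%:E =
    \int[mu]_z F (x, z).
  have mfx : measurable_fun setT (fun y : R => f (x + y)%R).
    by apply: measurableT_comp => //; exact: measurable_funD.
  have mg : measurable_fun setT
      (fun z : R => f z * (normal_pdf 0 s2 (z - x))%:E).
    apply: emeasurable_funM => //; apply/measurable_EFinP.
    apply: measurableT_comp; first exact: measurable_normal_pdf.
    exact: measurable_funB.
  have g0 (z : R) : 0 <= f z * (normal_pdf 0 s2 (z - x))%:E.
    by rewrite mule_ge0// lee_fin normal_pdf_ge0.
  rewrite /F/= [RHS]ge0_integralZr//; last by rewrite lee_fin normal_pdf_ge0.
  congr (_ * _).
  rewrite [LHS](ge0_integral_normal_prob 0 s2 mfx (fun=> f0 _)).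
  rewrite [RHS](ge0_integral_affine x (oner_neq0 _) mg g0) normr1 mul1e.
  by apply: eq_integral => y _; rewrite mul1r addrK (addrC y).
rewrite [LHS]ge0_integral_normal_prob; first last.
- by move=> x; exact: integral_ge0.
- exact: measurable_integral_normal_probD.
rewrite [RHS](ge0_integral_normal_prob 0 c mf f0).
transitivity (\int[mu]_x \int[mu]_z F (x, z)).
  by apply: eq_integral => x _; exact: innerE.
rewrite [LHS](fubini_tonelli (m1 := mu) (m2 := mu) F mF F0).
apply: eq_integral => z _; rewrite /F/=.
under eq_integral do rewrite -muleA -EFinM normal_pdf_conv// EFinM muleA.
rewrite ge0_integralZl//; first last.
- by rewrite mule_ge0// lee_fin normal_pdf_ge0.
- by move=> x _; rewrite lee_fin normal_pdf_ge0.
- exact: mpdf.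
by rewrite integral_normal_pdf mule1.
Qed.

Lemma integral_normal_prob_cst (m s : R) (k : \bar R) :
  \int[normal_prob m s]_x k = k.
Proof.
rewrite integral_cst// -[RHS]mule1; congr (_ * _).
exact: integral_normal_pdf.
Qed.

(** The density depends on [s] only through [s ^+ 2]; this absorbs the sign of a scaling factor. *)
Lemma integral_normal_prob_norm (s : R) f :
  \int[normal_prob 0 `|s|]_x f x = \int[normal_prob 0 s]_x f x.
Proof.
apply: eq_measure_integral => A _ _; apply: eq_integral => x _.
have [->|s0] := eqVneq s 0%R; first by rewrite normr0.
rewrite !normal_pdfE ?normr_eq0//.
by rewrite /normal_peak /normal_fun real_normK ?num_real.
Qed.

(** Scale each of the two independent normals, then convolve: the variances add. Zero coefficients
    are split off because scaling requires a nonzero factor. *)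
Lemma ge0_integral_normal_prob_comb (s a b : R) f : s != 0%R ->
  measurable_fun setT f -> (forall x, 0 <= f x) ->
  \int[normal_prob 0 s]_x \int[normal_prob 0 s]_y f (a * x + b * y)%R =
  \int[normal_prob 0 s]_x f (Num.sqrt (a ^+ 2 + b ^+ 2) * x)%R.
Proof.
move=> s0 mf f0.
have mfD t : measurable_fun setT (fun y : R => f (t + y)%R).
  by apply: measurableT_comp => //; exact: measurable_funD.
have fD0 t y : 0 <= f (t + y)%R by [].
have normE t : \int[normal_prob 0 s]_x f (`|t| * x)%R =
    \int[normal_prob 0 s]_x f (t * x)%R.
  have [->|t0] := eqVneq t 0%R; first by rewrite normr0.
  have nt0 : `|t|%R != 0%R by rewrite normr_eq0.
  rewrite [RHS](ge0_integral_normal_prob_scale s0 t0 mf f0).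
  rewrite [LHS](ge0_integral_normal_prob_scale s0 nt0 mf f0).
  rewrite -[LHS]integral_normal_prob_norm -[RHS]integral_normal_prob_norm.
  by rewrite !normrM normr_id.
have [->|a0] := eqVneq a 0%R.
  rewrite expr0n/= add0r sqrtr_sqr normE.
  under eq_integral do under eq_integral do rewrite mul0r add0r.
  exact: integral_normal_prob_cst.
have [->|b0] := eqVneq b 0%R.
  rewrite expr0n/= addr0 sqrtr_sqr normE; apply: eq_integral => x _.
  under eq_integral do rewrite mul0r addr0.
  exact: integral_normal_prob_cst.
have c0 : Num.sqrt (a ^+ 2 + b ^+ 2) != 0%R.
  by rewrite gt_eqF// sqrtr_gt0 ltr_pwDl ?sqr_ge0// exprn_even_gt0.
pose g x := \int[normal_prob 0 (b * s)]_y f (x + y)%R.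
have mg : measurable_fun setT g by exact: measurable_integral_normal_probD.
have g0 x : 0 <= g x by exact: integral_ge0.
transitivity (\int[normal_prob 0 s]_x g (a * x)%R).
  by apply: eq_integral => x _;
    exact: (ge0_integral_normal_prob_scale s0 b0 (mfD _) (fD0 _)).
rewrite [LHS](ge0_integral_normal_prob_scale s0 a0 mg g0).
have as0 : (a * s)%R != 0%R by rewrite mulf_neq0.
have bs0 : (b * s)%R != 0%R by rewrite mulf_neq0.
rewrite [LHS](ge0_integral_normal_prob_conv as0 bs0 mf f0).
rewrite [RHS](ge0_integral_normal_prob_scale s0 c0 mf f0).
have -> : (Num.sqrt ((a * s) ^+ 2 + (b * s) ^+ 2) =
           `|Num.sqrt (a ^+ 2 + b ^+ 2) * s|)%R.
  rewrite !exprMn -mulrDl sqrtrM ?addr_ge0 ?sqr_ge0// sqrtr_sqr.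
  by rewrite normrM (ger0_norm (sqrtr_ge0 _)).
exact: integral_normal_prob_norm.
Qed.

End normal_change_of_variables.

(** * The iterated Gaussian expectation *)

Section gauss_exp_theory.
Context {R : realType} (sigma : R).
Local Open Scope ereal_scope.
Local Notation GE := (gauss_exp sigma).

Lemma measurable_cons_tuple (m : nat) (t : R) :
  measurable_fun setT (fun u : m.-tuple R => cons_tuple t u).
Proof. exact: (@measurable_cons _ _ _ _ (cst t) m id). Qed.

(** The parameter space is arbitrary because the induction moves the first coordinate into it, from
    [T] to [T * R]. Measurability and nonnegativity go together since Tonelli's theorem uses
    both. *)
Lemma measurable_gauss_exp_param (m : nat) (d : measure_display)
    (T : measurableType d) (h : T * m.-tuple R -> \bar R) :
  measurable_fun setT h -> (forall p, 0 <= h p) ->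
  measurable_fun setT (fun z => GE (fun u => h (z, u))) /\
  (forall z, 0 <= GE (fun u => h (z, u))).
Proof.
elim: m d T h => [|m IHm] d T h mh h0 /=.
  by split=> //; apply: measurableT_comp => //; exact: measurable_pair2.
pose h' (p : (T * R) * m.-tuple R) := h (p.1.1, cons_tuple p.1.2 p.2).
have mh' : measurable_fun setT h'.
  apply: measurableT_comp => //; apply/measurable_fun_pairP; split => /=.
    exact: (measurableT_comp measurable_fst measurable_fst).
  apply: (@measurable_cons _ _ _ _
    (fun p : (T * R) * m.-tuple R => p.1.2) m snd) => //.
  exact: (measurableT_comp measurable_snd measurable_fst).
have [mG G0] := IHm _ _ h' mh' (fun _ => h0 _).
split.
- exact: (measurable_fun_fubini_tonelli_F
    (m2 := normal_prob 0 sigma) _ mG G0).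
- by move=> z; apply: integral_ge0 => t _; exact: (G0 (z, t)).
Qed.

Lemma gauss_exp_ge0 m (h : m.-tuple R -> \bar R) :
  measurable_fun setT h -> (forall u, 0 <= h u) -> 0 <= GE h.
Proof.
move=> mh h0.
by apply: (@measurable_gauss_exp_param m _ R (fun p => h p.2) _ _).2 0%R => //;
  exact: measurableT_comp.
Qed.

Lemma measurable_gauss_exp_cons m (h : m.+1.-tuple R -> \bar R) :
  measurable_fun setT h -> (forall u, 0 <= h u) ->
  measurable_fun setT (fun t => GE (fun u => h (cons_tuple t u))).
Proof.
move=> mh h0.
apply: (@measurable_gauss_exp_param m _ R
  (fun p => h (cons_tuple p.1 p.2)) _ _).1 => //.
apply: measurableT_comp => //.
exact: (@measurable_cons _ _ _ _ fst m snd).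
Qed.

Lemma measurable_comp_cons m (h : m.+1.-tuple R -> \bar R) t :
  measurable_fun setT h -> measurable_fun setT (fun u => h (cons_tuple t u)).
Proof. by move=> mh; apply: measurableT_comp => //; exact: measurable_cons_tuple. Qed.

Lemma gauss_exp_le m (h g : m.-tuple R -> \bar R) :
  measurable_fun setT h -> measurable_fun setT g ->
  (forall u, 0 <= h u) -> (forall u, h u <= g u) -> GE h <= GE g.
Proof.
elim: m h g => [|m IHm] h g mh mg h0 hg //=.
have g0 u : 0 <= g u by exact: le_trans (hg u).
apply: ge0_le_integral => //.
- by move=> t _; apply: gauss_exp_ge0 => //; exact: measurable_comp_cons.
- exact: measurable_gauss_exp_cons.
- exact: measurable_gauss_exp_cons.
- by move=> t _; apply: IHm => //; exact: measurable_comp_cons.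
Qed.

Lemma gauss_expD m (h g : m.-tuple R -> \bar R) :
  measurable_fun setT h -> measurable_fun setT g ->
  (forall u, 0 <= h u) -> (forall u, 0 <= g u) ->
  GE (fun u => h u + g u) = GE h + GE g.
Proof.
elim: m h g => [|m IHm] h g mh mg h0 g0 //=.
rewrite -ge0_integralD//; first last.
- exact: measurable_gauss_exp_cons.
- by move=> t _; apply: gauss_exp_ge0 => //; exact: measurable_comp_cons.
- exact: measurable_gauss_exp_cons.
- by move=> t _; apply: gauss_exp_ge0 => //; exact: measurable_comp_cons.
apply: eq_integral => t _.
by rewrite IHm//; exact: measurable_comp_cons.
Qed.

Lemma gauss_expZl m (r : R) (h : m.-tuple R -> \bar R) : (0 <= r)%R ->
  measurable_fun setT h -> (forall u, 0 <= h u) ->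
  GE (fun u => r%:E * h u) = r%:E * GE h.
Proof.
move=> r0; elim: m h => [|m IHm] h mh h0 //=.
rewrite -ge0_integralZl//; first last.
- by move=> t _; apply: gauss_exp_ge0 => //; exact: measurable_comp_cons.
- exact: measurable_gauss_exp_cons.
apply: eq_integral => t _.
by rewrite IHm//; exact: measurable_comp_cons.
Qed.

Lemma gauss_exp_sum m (I : Type) (s : seq I)
    (h : I -> m.-tuple R -> \bar R) :
  (forall i, measurable_fun setT (h i)) -> (forall i u, 0 <= h i u) ->
  GE (fun u => \sum_(i <- s) h i u) = \sum_(i <- s) GE (h i).
Proof.
move=> mh h0; elim: s => [|i s IHs].
  under eq_fun do rewrite big_nil.
  rewrite big_nil; have := @gauss_expZl m 0%R (cst 0) (lexx _).
  under eq_fun do rewrite mul0e.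
  by rewrite mul0e; apply.
under eq_fun do rewrite big_cons.
rewrite big_cons gauss_expD ?IHs//; first exact: emeasurable_sum.
by move=> u; exact: sume_ge0.
Qed.

Lemma gauss_exp_cst m (r : R) : GE (fun _ : m.-tuple R => r%:E) = r%:E.
Proof.
by elim: m => [|m IHm] //=; rewrite IHm integral_normal_prob_cst.
Qed.

Definition dot m (d e : m.-tuple R) : R := \sum_(i < m) tnth d i * tnth e i.

Lemma dot_cons m (x y : R) (d e : m.-tuple R) :
  dot (cons_tuple x d) (cons_tuple y e) = (x * y + dot d e)%R.
Proof.
rewrite /dot big_ord_recl !tnth0; congr (_ + _)%R.
by apply: eq_bigr => i _; rewrite !tnthS.
Qed.

Lemma vadd_cons m (x y : R) (d e : m.-tuple R) :
  vadd (cons_tuple x d) (cons_tuple y e) = cons_tuple (x + y)%R (vadd d e).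
Proof.
apply: eq_from_tnth => i; rewrite tnth_mktuple.
have [j ->|->] := unliftP ord0 i; last by rewrite !tnth0.
by rewrite !tnthS tnth_mktuple.
Qed.

Lemma dot_vaddr m (x y z : m.-tuple R) :
  dot x (vadd y z) = (dot x y + dot x z)%R.
Proof.
rewrite /dot -big_split; apply: eq_bigr => i _ /=.
by rewrite tnth_mktuple mulrDr.
Qed.

Lemma norm2_sqr m (d : m.-tuple R) : (norm2 d ^+ 2 = dot d d)%R.
Proof.
rewrite sqr_sqrtr; last by apply: sumr_ge0 => i _; exact: sqr_ge0.
by apply: eq_bigr => i _; rewrite expr2.
Qed.

Lemma norm2_cons m (x : R) (d : m.-tuple R) :
  norm2 (cons_tuple x d) = Num.sqrt (x ^+ 2 + norm2 d ^+ 2).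
Proof.
rewrite norm2_sqr expr2 -dot_cons -norm2_sqr sqrtr_sqr ger0_norm//.
exact: sqrtr_ge0.
Qed.

Lemma measurable_dot m (d : m.-tuple R) : measurable_fun setT (dot d).
Proof.
apply: measurable_sum => i; apply: measurable_funM => //.
exact: measurable_tnth.
Qed.

Lemma measurable_vadd m (d : m.-tuple R) : measurable_fun setT (vadd d).
Proof.
apply/measurable_fun_tnthP => i /=.
rewrite (_ : _ \o _ = fun e => (tnth d i + tnth e i)%R).
  by apply: measurable_funD => //; exact: measurable_tnth.
by apply/funext => e /=; rewrite tnth_mktuple.
Qed.

Hypothesis sigma0 : sigma != 0%R.

(** Likelihood ratio at [e] of N(d, sigma^2 I) against N(0, sigma^2 I). *)
Definition shift_density m (d e : m.-tuple R) : R :=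
  expR (dot d e / sigma ^+ 2 - dot d d / (2 * sigma ^+ 2)).

Lemma measurable_shift_density m (d : m.-tuple R) :
  measurable_fun setT (shift_density d).
Proof.
apply: measurableT_comp => //; apply: measurable_funB => //.
by apply: measurable_funM => //; exact: measurable_dot.
Qed.

(** The likelihood ratio is the product of its one-dimensional factors, so the one-dimensional shift
    is applied to one coordinate at a time. *)
Lemma gauss_exp_shift m (d : m.-tuple R) (h : m.-tuple R -> \bar R) :
  measurable_fun setT h -> (forall u, 0 <= h u) ->
  GE (fun e => h (vadd d e)) = GE (fun e => (shift_density d e)%:E * h e).
Proof.
elim: m d h => [|m IHm] d h mh h0.
  rewrite /= /shift_density /dot !big_ord0 !mul0r subrr expR0 mul1e.
  by congr h; rewrite tuple0 [RHS]tuple0.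
case/tupleP: d => x d /=.
pose W t := GE (fun u => (shift_density d u)%:E * h (cons_tuple t u)).
have mdh : measurable_fun setT
    (fun u : m.+1.-tuple R => (shift_density d [tuple of behead u])%:E * h u).
  apply: emeasurable_funM => //; apply/measurable_EFinP.
  apply: measurableT_comp; first exact: measurable_shift_density.
  exact: measurable_behead.
have dh0 (u : m.+1.-tuple R) : 0 <= (shift_density d [tuple of behead u])%:E * h u.
  by rewrite mule_ge0// lee_fin expR_ge0.
(* Through [behead], the integrand of [W] becomes a section of a function of [m.+1] coordinates, to
   which the measurability lemmas apply. *)
have beheadE t (u : m.-tuple R) : [tuple of behead (cons_tuple t u)] = u.
  exact: val_inj.
have WE : W = fun t => GE (fun u => (shift_density d
     [tuple of behead (cons_tuple t u)])%:E * h (cons_tuple t u)).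
  by apply/funext => t; under eq_fun do rewrite beheadE.
have mW : measurable_fun setT W.
  by rewrite WE; exact: (measurable_gauss_exp_cons mdh).
have W0 t : 0 <= W t.
  by rewrite WE; apply: gauss_exp_ge0 => //; exact: (measurable_comp_cons _ mdh).
transitivity (\int[normal_prob 0 sigma]_t W (x + t)%R).
  apply: eq_integral => t _; rewrite /W -IHm//; last exact: measurable_comp_cons.
  by congr gauss_exp; apply/funext => u; rewrite -vadd_cons.
rewrite ge0_integral_normal_prob_shift//; apply: eq_integral => t _.
rewrite /W -gauss_expZl ?expR_ge0//; first last.
- by move=> u; rewrite mule_ge0// lee_fin expR_ge0.
- apply: emeasurable_funM; last exact: measurable_comp_cons.
  by apply/measurable_EFinP; exact: measurable_shift_density.
congr gauss_exp; apply/funext => u; rewrite muleA -EFinM /shift_density -expRD.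
rewrite !dot_cons.
congr ((expR _)%:E * _); field; exact: sigma0.
Qed.

(** The induction hypothesis, used on a translate of [phi], reduces the tail to one normal variable
    with coefficient [norm2 d]; the combination of two normals then merges it with the first
    coordinate. *)
Lemma gauss_exp_dot m (d : m.-tuple R) (phi : R -> \bar R) :
  measurable_fun setT phi -> (forall t, 0 <= phi t) ->
  GE (fun e => phi (dot d e)) =
  \int[normal_prob 0 sigma]_t phi (norm2 d * t)%R.
Proof.
elim: m d phi => [|m IHm] d phi mphi phi0.
  rewrite /= /dot /norm2 !big_ord0 sqrtr0.
  under eq_integral do rewrite mul0r.
  by rewrite integral_normal_prob_cst.
case/tupleP: d => x d /=; rewrite norm2_cons.
rewrite -(ge0_integral_normal_prob_comb x (norm2 d) sigma0 mphi phi0).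
apply: eq_integral => t _.
under eq_fun do rewrite dot_cons.
rewrite (IHm d (fun y => phi (x * t + y)%R))//.
by apply: measurableT_comp => //; exact: measurable_funD.
Qed.

End gauss_exp_theory.

(** * The normal distribution function and its quantiles *)

Section Phi_theory.
Context {R : realType}.
Implicit Types x y p : R.

Lemma PhiEFin x : (Phi x)%:E = normal_prob 0 1 `]-oo, x].
Proof. by rewrite /Phi fineK// fin_num_measure. Qed.

Lemma Phi_ge0 x : 0 <= Phi x.
Proof. by rewrite -lee_fin PhiEFin. Qed.

Lemma Phi_le1 x : Phi x <= 1.
Proof. by rewrite -lee_fin PhiEFin; exact: probability_le1. Qed.

Lemma Phi_nondecreasing x y : x <= y -> Phi x <= Phi y.
Proof.
by move=> xy; rewrite -lee_fin !PhiEFin le_measure ?inE//; exact: subset_itvl.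
Qed.

(** The density is at most its peak. This gives the continuity of [Phi] that makes quantiles
    exact. *)
Lemma Phi_lipschitz x y : x <= y -> Phi y <= Phi x + normal_peak 1 * (y - x).
Proof.
move=> xy; rewrite -lee_fin EFinD !PhiEFin.
have -> : `]-oo, y]%classic = `]-oo, x] `|` `]x, y] :> set (measurableTypeR R).
  by rewrite -itv_bndbnd_setU// bnd_simp.
rewrite (measureU (normal_prob 0 1))//=; last first.
  rewrite -subset0 => z [] /=; rewrite !in_itv/= => zx /andP[].
  by rewrite ltNge zx.
apply: leeD => //; rewrite /normal_prob.
apply: (@le_trans _ _ (\int[lebesgue_measure]_(z in `]x, y]) (normal_peak 1)%:E)%E).
  apply: ge0_le_integral => //=.
  - by move=> z _; rewrite lee_fin normal_pdf_ge0.
  - apply/measurable_EFinP; apply: measurable_funTS.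
    exact: measurable_normal_pdf.
  - by move=> z _; rewrite lee_fin normal_pdf_ub.
rewrite integral_cst//= lebesgue_measure_itv/= lte_fin.
case: ifPn => [_|]; first by rewrite -EFinB -EFinM.
by rewrite mule0 lee_fin mulr_ge0 ?normal_peak_ge0 ?subr_ge0.
Qed.

Lemma Phi_gt1B e : 0 < e -> exists x, 1 - e < Phi x.
Proof.
move=> e0.
pose F n : set (measurableTypeR R) := `]-oo, n%:R]%classic.
have mF n : measurable (F n) by exact: measurable_itv.
have UF : \bigcup_n F n = setT.
  rewrite -subTset => t _/=.
  exists (Num.bound `|t|) => //; rewrite /F/= in_itv/= ltW//.
  by rewrite (le_lt_trans (ler_norm _))// archi_boundP.
have cF : normal_prob 0 1 (F n) @[n --> \oo] --> (1 : \bar R)%E.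
  rewrite -(probability_setT (normal_prob 0 1)) -UF.
  apply: nondecreasing_cvg_mu => //; first exact: bigcup_measurable.
  move=> n m nm; apply/subsetPset; apply: subset_itvl.
  by rewrite bnd_simp ler_nat.
have {}cF : Phi n%:R @[n --> \oo] --> (1 : R).
  have -> : (fun n => Phi n%:R) = fine \o (fun n => normal_prob 0 1 (F n)) by [].
  exact: fine_cvg.
have e1 : 1 - e < 1 by rewrite ltrBlDr ltrDl.
have [n ?] := filter_ex (cvgr_gt 1 cF (1 - e) e1).
by exists n%:R.
Qed.

Lemma Phi_lt e : 0 < e -> exists x, Phi x < e.
Proof.
move=> e0.
pose F n : set (measurableTypeR R) := `]-oo, - n%:R]%classic.
have mF n : measurable (F n) by exact: measurable_itv.
have IF : \bigcap_n F n = set0.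
  rewrite -subset0 => t /(_ (Num.bound `|t|) I).
  rewrite /F/= in_itv/= leNgt => /negP; apply; rewrite ltrNl.
  by rewrite (le_lt_trans (ler_norm _))// normrN archi_boundP.
have cF : normal_prob 0 1 (F n) @[n --> \oo] --> (0 : \bar R)%E.
  rewrite -(measure0 (normal_prob 0 1)) -IF.
  apply: nonincreasing_cvg_mu => //=.
  + by rewrite (le_lt_trans (probability_le1 _ _)) ?ltry.
  + exact: bigcap_measurable.
  + move=> n m nm; apply/subsetPset; apply: subset_itvl.
    by rewrite bnd_simp lerN2 ler_nat.
have {}cF : Phi (- n%:R) @[n --> \oo] --> (0 : R).
  have -> : (fun n => Phi (- n%:R)) =
    fine \o (fun n => normal_prob 0 1 (F n)) by [].
  exact: fine_cvg.
have [n ?] := filter_ex (cvgr_lt 0 cF e e0).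
by exists (- n%:R).
Qed.

(** In each direction, a step of length at most [e / normal_peak 1] away from the infimum changes
    [Phi] by at most [e]. *)
Lemma PhiInvK p : 0 < p < 1 -> Phi (inf [set x | p <= Phi x]) = p.
Proof.
move=> /andP[p0 p1]; set S := [set x | p <= Phi x].
have hS : has_inf S.
  split.
    have [|x] := @Phi_gt1B (1 - p); first by rewrite subr_gt0.
    by rewrite subKr => /ltW; exists x.
  have [x xp] := Phi_lt p0; exists x => y /= py.
  rewrite leNgt; apply/negP => /ltW /Phi_nondecreasing.
  by rewrite leNgt (lt_le_trans xp).
have peak0 : 0 < normal_peak (1 : R) by rewrite normal_peak_gt0.
apply/eqP; rewrite eq_le; apply/andP; split; apply/ler_addgt0Pr => e e0.
- have e'0 : 0 < e / normal_peak (1 : R) by rewrite divr_gt0.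
  have /ltW le_p : Phi (inf S - e / normal_peak 1) < p.
    rewrite ltNge; apply/negP => /(ge_inf hS.2).
    by rewrite leNgt ltrBlDr ltrDl e'0.
  apply: le_trans (Phi_lipschitz (_ : inf S - e / normal_peak 1 <= _)) _.
    by rewrite lerBlDr lerDl ltW.
  by rewrite subKr mulrCA divff ?gt_eqF// mulr1 lerD2r.
- have e'0 : 0 < e / normal_peak (1 : R) by rewrite divr_gt0.
  have [x /= px xlt] := inf_adherent e'0 hS.
  have iSx : inf S <= x by exact: ge_inf hS.2 _ px.
  apply: (le_trans px); apply: le_trans (Phi_lipschitz iSx) _.
  rewrite lerD2l mulrC -ler_pdivlMr// lerBlDl; exact: ltW.
Qed.

End Phi_theory.

(** * The Neyman-Pearson bounds *)

Section neyman_pearson.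
Context {R : realType} (sigma : R) (m : nat).
Hypothesis sigma_gt0 : 0 < sigma.
Local Notation GE h := (gauss_exp sigma (fun e => (h e)%:E)).
Implicit Types (d e : m.-tuple R) (h g : m.-tuple R -> R).

Let sigma0 : sigma != 0. Proof. by rewrite gt_eqF. Qed.

(** [<d, e>] is centred normal with standard deviation [norm2 d * sigma], so this threshold is its
    quantile at level [Phi q]. *)
Lemma gauss_exp_halfspace d (q : R) : norm2 d != 0 ->
  GE (fun e => (dot d e <= norm2 d * (sigma * q))%R%:R) = (Phi q)%:E.
Proof.
move=> d0; have d_gt0 : 0 < norm2 d by rewrite lt0r d0 sqrtr_ge0.
have mphi (c : R) : measurable_fun setT (fun t : R => ((t <= c)%R%:R : R)%:E).
  apply/measurable_EFinP.
  rewrite (_ : (fun t => _) = \1_(`]-oo, c]%classic : set R)).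
    exact: measurable_indic.
  by apply/funext => t; rewrite indicE mem_setE in_itv.
have phi0 (c t : R) : (0 <= ((t <= c)%R%:R : R)%:E)%E by rewrite lee_fin.
rewrite [LHS](gauss_exp_dot sigma0 d (mphi (norm2 d * (sigma * q))) (phi0 _)).
transitivity (\int[normal_prob 0 (sigma * 1)]_t ((t <= sigma * q)%R%:R : R)%:E)%E.
  rewrite mulr1; apply: eq_integral => t _; by rewrite ler_pM2l.
rewrite -[LHS](ge0_integral_normal_prob_scale (oner_neq0 R) sigma0 (mphi _) (phi0 _)).
transitivity (\int[normal_prob 0 1]_t (\1_(`]-oo, q]%classic : set R) t)%:E)%E.
  by apply: eq_integral => t _; rewrite ler_pM2l// indicE mem_setE in_itv.
by rewrite integral_indic// setIT PhiEFin.
Qed.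

Lemma gauss_exp_unit_interval h : measurable_fun setT h ->
  (forall e, 0 <= h e <= 1) -> (0 <= GE h <= 1)%E.
Proof.
move=> mh h01.
have mh' : measurable_fun setT (EFin \o h) by apply/measurable_EFinP.
have h0 e : (0 <= (EFin \o h) e)%E by rewrite lee_fin; case/andP: (h01 e).
apply/andP; split; first exact: gauss_exp_ge0 mh' h0.
rewrite -[leRHS](gauss_exp_cst sigma m 1); apply: (gauss_exp_le _ mh') => // e.
by rewrite lee_fin; case/andP: (h01 e).
Qed.

Lemma gauss_exp_fin_num h : measurable_fun setT h ->
  (forall e, 0 <= h e <= 1) -> GE h \is a fin_num.
Proof.
move=> mh h01; have /andP[E0 E1] := gauss_exp_unit_interval mh h01.
by rewrite ge0_fin_numE// (le_lt_trans E1)// ltry.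
Qed.

(* Weak duality: the test [g] beats [h] as soon as it selects the points where
   the likelihood ratio lies on the right side of the threshold [l]. *)
Lemma gauss_exp_shift_le d h g (l : R) :
  measurable_fun setT h -> measurable_fun setT g ->
  (forall e, 0 <= h e <= 1) -> (forall e, 0 <= g e <= 1) -> 0 <= l ->
  (forall e, 0 <= (g e - h e) * (shift_density sigma d e - l)) ->
  (GE h <= GE g)%E ->
  (GE (fun e => h (vadd d e)) <= GE (fun e => g (vadd d e)))%E.
Proof.
move=> mh mg h01 g01 l0 hg Ehg.
have h0 e : (0 <= (h e)%:E)%E by rewrite lee_fin; case/andP: (h01 e).
have g0 e : (0 <= (g e)%:E)%E by rewrite lee_fin; case/andP: (g01 e).
have mh' : measurable_fun setT (fun e => (h e)%:E) by apply/measurable_EFinP.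
have mg' : measurable_fun setT (fun e => (g e)%:E) by apply/measurable_EFinP.
have mW f : measurable_fun setT (fun e => (f e)%:E) ->
    measurable_fun setT (fun e => (shift_density sigma d e)%:E * (f e)%:E)%E.
  move=> mf; apply: emeasurable_funM => //.
  by apply/measurable_EFinP; exact: measurable_shift_density.
have ml f : measurable_fun setT (fun e => (f e)%:E) ->
    measurable_fun setT (fun e : m.-tuple R => l%:E * (f e)%:E)%E.
  by move=> mf; apply: emeasurable_funM.
have W0 f : (forall e, 0 <= (f e)%:E)%E ->
    forall e, (0 <= (shift_density sigma d e)%:E * (f e)%:E)%E.
  by move=> f0 e; rewrite mule_ge0// lee_fin expR_ge0.
have l0' f : (forall e, 0 <= (f e)%:E)%E ->
    forall e : m.-tuple R, (0 <= l%:E * (f e)%:E)%E.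
  by move=> f0 e; rewrite mule_ge0.
rewrite [leLHS](gauss_exp_shift sigma0 d mh' h0).
rewrite [leRHS](gauss_exp_shift sigma0 d mg' g0).
have fing := gauss_exp_fin_num mg g01.
(* Adding a finite term to both sides avoids subtraction of extended reals: with [W] the likelihood
   ratio, the pointwise hypothesis reads [W * h + l * g <= W * g + l * h]. *)
rewrite -(@leeD2rE _ (l%:E * GE g)) ?fin_numM//.
apply: (@le_trans _ _
  (gauss_exp sigma (fun e => (shift_density sigma d e)%:E * (g e)%:E) +
   l%:E * GE h)%E); last by rewrite leeD2l// lee_wpmul2l.
rewrite -(gauss_expZl sigma l0 mg' g0) -(gauss_expZl sigma l0 mh' h0).
rewrite -(gauss_expD sigma (mW _ mh') (ml _ mg') (W0 _ h0) (l0' _ g0)).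
rewrite -(gauss_expD sigma (mW _ mg') (ml _ mh') (W0 _ g0) (l0' _ h0)).
apply: gauss_exp_le.
- by apply: emeasurable_funD; [exact: mW|exact: ml].
- by apply: emeasurable_funD; [exact: mW|exact: ml].
- by move=> e; rewrite adde_ge0//; [exact: W0|exact: l0'].
- move=> e; rewrite -!EFinM -!EFinD lee_fin -subr_ge0.
  by apply: le_trans (hg e) _; rewrite le_eqVlt; apply/orP; left; apply/eqP; ring.
Qed.

Lemma measurable_halfspace d (c : R) :
  measurable_fun setT (fun e => (dot d e <= c)%R%:R : R).
Proof.
rewrite (_ : (fun e => _) = \1_(`]-oo, c]%classic : set R) \o dot d).
  apply: measurableT_comp; last exact: measurable_dot.
  exact: measurable_indic.
by apply/funext => e; rewrite /= indicE mem_setE in_itv.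
Qed.

Lemma norm2_eq0_vadd d e : norm2 d = 0 -> vadd d e = e.
Proof.
move=> d0; apply: eq_from_tnth => i; rewrite tnth_mktuple.
have := norm2_sqr d; rewrite d0 expr0n/= => /esym/eqP.
rewrite psumr_eq0 => [/allP/(_ i)|j _]; last by rewrite -expr2 sqr_ge0.
by rewrite mem_index_enum => /(_ isT); rewrite -expr2 sqrf_eq0 => /eqP ->; rewrite add0r.
Qed.

(** The extremal test is the half-space on the side of [d], where the likelihood ratio is large.
    Translating by [d] moves its threshold by [norm2 d ^+ 2], which is [norm2 d / sigma] standard
    deviations. *)
Lemma gauss_exp_shift_Phi_ub d h (q : R) : measurable_fun setT h ->
  (forall e, 0 <= h e <= 1) -> (GE h <= (Phi q)%:E)%E ->
  (GE (fun e => h (vadd d e)) <= (Phi (q + norm2 d / sigma))%:E)%E.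
Proof.
move=> mh h01 hq; have [d0|d0] := eqVneq (norm2 d) 0.
  by under eq_fun do rewrite norm2_eq0_vadd//; rewrite d0 mul0r addr0.
(* Negating [d] turns a condition [<d', e> <= c] into [<d, e> >= - c]. *)
pose d' : m.-tuple R := [tuple - tnth d i | i < m].
have d'E e : dot d' e = - dot d e.
  by rewrite /dot -sumrN; apply: eq_bigr => i _; rewrite tnth_mktuple mulNr.
have nd' : norm2 d' = norm2 d.
  by congr Num.sqrt; apply: eq_bigr => i _; rewrite tnth_mktuple sqrrN.
have nd'0 : norm2 d' != 0 by rewrite nd'.
pose g e : R := (dot d' e <= norm2 d' * (sigma * q))%R%:R.
have gE : GE (fun e => g (vadd d e)) = (Phi (q + norm2 d / sigma))%:E.
  rewrite -(gauss_exp_halfspace _ nd'0); congr gauss_exp; apply/funext => e.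
  rewrite /g dot_vaddr !d'E -norm2_sqr nd' -lerBrDl; congr ((_ <= _)%R%:R%:E).
  by field; exact: sigma0.
(* The threshold is the value of the likelihood ratio on the boundary of the half-space, where
   [<d, e> = - norm2 d * sigma * q]. *)
rewrite -gE; apply: (@gauss_exp_shift_le d h g
    (expR (- (norm2 d * q / sigma) - norm2 d ^+ 2 / (2 * sigma ^+ 2)))) => //.
- exact: measurable_halfspace.
- by move=> e; rewrite /g ler0n lern1 leq_b1.
- move=> e; have /andP[h0 h1] := h01 e.
  rewrite /g nd' d'E /shift_density -norm2_sqr.
  have -> : norm2 d * q / sigma = norm2 d * (sigma * q) / sigma ^+ 2.
    by field; exact: sigma0.
  have s2 : 0 < (sigma ^+ 2)^-1 by rewrite invr_gt0 exprn_gt0.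
  have [dq|dq] := leP (- dot d e) (norm2 d * (sigma * q)).
  + by apply: mulr_ge0; rewrite subr_ge0// ler_expR lerD2r -mulNr ler_pM2r// lerNl.
  + apply: mulr_le0; rewrite subr_le0// ler_expR lerD2r -mulNr ler_pM2r// lerNr.
    exact: ltW.
- by rewrite (gauss_exp_halfspace _ nd'0).
Qed.

(** Mirror image: the half-space lies on the side of small likelihood ratio and enters
    [gauss_exp_shift_le] as the test that is beaten. *)
Lemma gauss_exp_shift_Phi_lb d h (q : R) : measurable_fun setT h ->
  (forall e, 0 <= h e <= 1) -> ((Phi q)%:E <= GE h)%E ->
  ((Phi (q - norm2 d / sigma))%:E <= GE (fun e => h (vadd d e)))%E.
Proof.
move=> mh h01 hq; have [d0|d0] := eqVneq (norm2 d) 0.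
  by under eq_fun do rewrite norm2_eq0_vadd//; rewrite d0 mul0r subr0.
pose g e : R := (dot d e <= norm2 d * (sigma * q))%R%:R.
have gE : GE (fun e => g (vadd d e)) = (Phi (q - norm2 d / sigma))%:E.
  rewrite -(gauss_exp_halfspace _ d0); congr gauss_exp; apply/funext => e.
  rewrite /g dot_vaddr -norm2_sqr -lerBrDl; congr ((_ <= _)%R%:R%:E).
  by field; exact: sigma0.
rewrite -gE; apply: (@gauss_exp_shift_le d g h
    (expR (norm2 d * q / sigma - norm2 d ^+ 2 / (2 * sigma ^+ 2)))) => //.
- exact: measurable_halfspace.
- by move=> e; rewrite /g ler0n lern1 leq_b1.
- move=> e; have /andP[h0 h1] := h01 e.
  rewrite /g /shift_density -norm2_sqr.
  have -> : norm2 d * q / sigma = norm2 d * (sigma * q) / sigma ^+ 2.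
    by field; exact: sigma0.
  have s2 : 0 < (sigma ^+ 2)^-1 by rewrite invr_gt0 exprn_gt0.
  have [dq|dq] := leP (dot d e) (norm2 d * (sigma * q)).
  + by apply: mulr_le0; rewrite subr_le0// ler_expR lerD2r ler_pM2r.
  + by apply: mulr_ge0; rewrite subr_ge0// ler_expR lerD2r ler_pM2r// ltW.
- by rewrite (gauss_exp_halfspace _ d0).
Qed.

(** For [0 < p < 1] the half-space is cut at the quantile of [p], and monotonicity of [Phi] replaces
    [norm2 d / sigma] by [r]. Infinite quantiles are treated separately. *)
Lemma gauss_mean_shift_ub d h (p r : R) : measurable_fun setT h ->
  (forall e, 0 <= h e <= 1) -> norm2 d / sigma <= r -> fine (GE h) <= p ->
  fine (GE (fun e => h (vadd d e))) <= PhiE (PhiInv p + r%:E)%E.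
Proof.
move=> mh h01 dr hp.
have mhd : measurable_fun setT (fun e => h (vadd d e)).
  by apply: measurableT_comp => //; exact: measurable_vadd.
have finh := gauss_exp_fin_num mh h01.
have finhd := gauss_exp_fin_num mhd (fun=> h01 _).
have ubq q : p <= Phi q ->
    fine (GE (fun e => h (vadd d e))) <= Phi (q + norm2 d / sigma).
  move=> pq; rewrite -lee_fin (fineK finhd); apply: gauss_exp_shift_Phi_ub => //.
  by rewrite -(fineK finh) lee_fin (le_trans hp).
rewrite /PhiInv; case: ifPn => [p0|]; last rewrite -ltNge => p0.
  (* The quantile is [-oo] and the claimed bound is 0. Every real [q] satisfies [p <= Phi q], so [q]
     is chosen far enough to the left. *)
  apply/ler_addgt0Pr => e e0 /=.
  have [x xe] := Phi_lt e0; rewrite add0r; apply: le_trans (ltW xe).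
  have := ubq (x - norm2 d / sigma); rewrite subrK; apply.
  exact: le_trans p0 (Phi_ge0 _).
case: ifPn => [p1|]; last rewrite -ltNge => p1 /=.
  rewrite /= -lee_fin fineK//.
  by have /andP[] := gauss_exp_unit_interval mhd (fun=> h01 _).
apply: le_trans (ubq (inf [set x | p <= Phi x]) _) _.
  by rewrite PhiInvK// p0.
by apply: Phi_nondecreasing; rewrite lerD2l.
Qed.

Lemma gauss_mean_shift_lb d h (p r : R) : measurable_fun setT h ->
  (forall e, 0 <= h e <= 1) -> norm2 d / sigma <= r -> p <= fine (GE h) ->
  PhiE (PhiInv p - r%:E)%E <= fine (GE (fun e => h (vadd d e))).
Proof.
move=> mh h01 dr hp.
have mhd : measurable_fun setT (fun e => h (vadd d e)).
  by apply: measurableT_comp => //; exact: measurable_vadd.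
have finh := gauss_exp_fin_num mh h01.
have finhd := gauss_exp_fin_num mhd (fun=> h01 _).
have lbq q : Phi q <= p ->
    Phi (q - norm2 d / sigma) <= fine (GE (fun e => h (vadd d e))).
  move=> pq; rewrite -lee_fin (fineK finhd); apply: gauss_exp_shift_Phi_lb => //.
  by rewrite -(fineK finh) lee_fin (le_trans pq).
rewrite /PhiInv; case: ifPn => [p0|]; last rewrite -ltNge => p0.
  rewrite /= -lee_fin fineK//.
  by have /andP[] := gauss_exp_unit_interval mhd (fun=> h01 _).
case: ifPn => [p1|]; last rewrite -ltNge => p1 /=.
  (* The quantile is [+oo] and the claimed lower bound is 1, approached by choosing [q] far enough
     to the right. *)
  apply/ler_addgt0Pr => e e0 /=.
  have [x xe] := @Phi_gt1B R e e0; rewrite -lerBlDr; apply: le_trans (ltW xe) _.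
  have := lbq (x + norm2 d / sigma); rewrite addrK; apply.
  exact: le_trans (Phi_le1 _) p1.
apply: le_trans (lbq (inf [set x | p <= Phi x]) _).
  by apply: Phi_nondecreasing; rewrite lerD2l lerN2.
by rewrite PhiInvK// p0.
Qed.

End neyman_pearson.

(** * Sums of label probabilities *)

Section label_sums.
Context {R : realType} (sigma : R) (m c : nat) (f : m.-tuple R -> {set 'I_c}).
Hypothesis sigma_gt0 : 0 < sigma.
Hypothesis mf : forall i : 'I_c, measurable [set w : m.-tuple R | i \in f w].
Variables (s : seq 'I_c) (N : nat).
Hypothesis N_gt0 : (0 < N)%N.
Hypothesis countN : forall w, (count (mem (f w)) s <= N)%N.

(** Dividing by a bound [N] on the count gives a test with values in [0, 1]. Both kinds of terms of
    the certificate come from it: [N = k'] for a group of labels, [N = 1] for a single label. *)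
Let freq w : R := N%:R^-1 * \sum_(i <- s) (i \in f w)%:R.

Let m_mem i : measurable_fun setT (fun w => (i \in f w)%:R : R).
Proof.
rewrite (_ : (fun w => _) = \1_[set w | i \in f w]).
  exact: measurable_indic.
apply/funext => w; rewrite indicE.
suff -> : (w \in [set w' | i \in f w']) = (i \in f w) by [].
by apply/idP/idP => [/set_mem//|iw]; exact: mem_set.
Qed.

Let m_freq : measurable_fun setT freq.
Proof. by apply: measurable_funM => //; exact: measurable_sum. Qed.

Let freq01 w : 0 <= freq w <= 1.
Proof.
have -> : freq w = N%:R^-1 * (count (mem (f w)) s)%:R.
  by rewrite /freq -natr_sum -sumn_count sumnE big_map.
rewrite mulr_ge0 ?invr_ge0 ?ler0n//= mulrC ler_pdivrMr ?ltr0n// mul1r.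
by rewrite ler_nat.
Qed.

Let mean_freq z : fine (gauss_exp sigma (fun e => (freq (vadd z e))%:E)) =
  (\sum_(i <- s) label_prob sigma f z i) / N%:R.
Proof.
have mz i : measurable_fun setT (fun e => ((i \in f (vadd z e))%:R : R)).
  exact: (measurableT_comp (m_mem i) (measurable_vadd z)).
have mzE i : measurable_fun setT (fun e => ((i \in f (vadd z e))%:R : R)%:E).
  exact/measurable_EFinP.
have fin_i i : gauss_exp sigma (fun e => ((i \in f (vadd z e))%:R : R)%:E)
    \is a fin_num.
  apply: (gauss_exp_fin_num _ (mz i)) => e.
  by rewrite ler0n lern1 leq_b1.
under eq_fun do rewrite EFinM -sumEFin.
rewrite gauss_expZl ?invr_ge0 ?ler0n//; first last.
- by move=> e; apply: sume_ge0 => i _; rewrite lee_fin.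
- exact: emeasurable_sum.
rewrite gauss_exp_sum//.
rewrite (eq_bigr (fun i => (label_prob sigma f z i)%:E)); last first.
  by move=> i _; rewrite [RHS]fineK.
by rewrite sumEFin -EFinM/= mulrC.
Qed.

Let vaddA x y z : vadd (vadd x y) z = vadd x (vadd y z) :> m.-tuple R.
Proof. by apply: eq_from_tnth => i; rewrite !tnth_mktuple addrA. Qed.

Lemma sum_label_prob_shift_lb x d (t r : R) : norm2 d / sigma <= r ->
  t <= \sum_(i <- s) label_prob sigma f x i ->
  N%:R * PhiE (PhiInv (t / N%:R) - r%:E)%E <=
  \sum_(i <- s) label_prob sigma f (vadd x d) i.
Proof.
move=> dr tle; rewrite mulrC -ler_pdivlMr ?ltr0n// -mean_freq.
under eq_fun do rewrite vaddA.
apply: (gauss_mean_shift_lb sigma_gt0 (h := fun e => freq (vadd x e))) => //.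
  exact: (measurableT_comp m_freq (measurable_vadd x)).
by rewrite mean_freq ler_pM2r ?invr_gt0 ?ltr0n.
Qed.

Lemma sum_label_prob_shift_ub x d (t r : R) : norm2 d / sigma <= r ->
  \sum_(i <- s) label_prob sigma f x i <= t ->
  \sum_(i <- s) label_prob sigma f (vadd x d) i <=
  N%:R * PhiE (PhiInv (t / N%:R) + r%:E)%E.
Proof.
move=> dr tle; rewrite [leRHS]mulrC -ler_pdivrMr ?ltr0n// -mean_freq.
under eq_fun do rewrite vaddA.
apply: (gauss_mean_shift_ub sigma_gt0 (h := fun e => freq (vadd x e))) => //.
  exact: (measurableT_comp m_freq (measurable_vadd x)).
by rewrite mean_freq ler_pM2r ?invr_gt0 ?ltr0n.
Qed.

End label_sums.

(** * Subsequences of nonincreasing sequences *)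

Section sorted_subseq.
Context {R : realType}.
Implicit Types s t : seq R.

Let ge_nth t i j : sorted (fun x y => y <= x) t -> (i <= j)%N ->
  (j < size t)%N -> nth 0 t j <= nth 0 t i.
Proof.
move=> st ij jt; apply: (sorted_leq_nth _ _ _ st) => //.
- by move=> x y z yx zx; exact: le_trans yx.
- by rewrite inE (leq_ltn_trans ij).
Qed.

(** The entry at index [l] of [s] has [l] predecessors there, so it sits at index [l] or later in
    [t]. *)
Lemma nth_subseq_le s t l : sorted (fun x y => y <= x) t -> subseq s t ->
  (l < size s)%N -> nth 0 s l <= nth 0 t l.
Proof.
elim: t s l => [|y t IHt] s l st; first by move/eqP ->.
case: s => [//|x s]; rewrite [subseq _ _]/=.
case: eqP => [->|_] sub; case: l => [|l] ls //=.
- by apply: IHt => //; exact: path_sorted st.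
- have lt : (0 < size t)%N by apply: leq_trans (size_subseq sub).
  apply: le_trans (ge_nth st (leq0n 1) _) => //=.
  by apply: (IHt (x :: s) 0%N) => //; exact: path_sorted st.
- have lt : (l.+1 < size t)%N by apply: leq_trans (size_subseq sub).
  apply: le_trans (ge_nth st (leqnSn l.+1) _) => //=.
  by apply: (IHt (x :: s) l.+1) => //; exact: path_sorted st.
Qed.

(** The [size s - l - 1] entries that follow index [l] in [s] must also follow in [t], so the entry
    sits in [t] at index [l + (size t - size s)] or earlier. *)
Lemma nth_subseq_ge s t l j : sorted (fun x y => y <= x) t -> subseq s t ->
  (l < size s)%N -> (l + (size t - size s) <= j < size t)%N ->
  nth 0 t j <= nth 0 s l.
Proof.
elim: t s l j => [|y t IHt] s l j st; first by rewrite ltn0 andbF.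
case: s => [//|x s]; rewrite [subseq _ _]/=.
case: eqP => [->|_] sub ls /andP[lj jt].
- case: l ls lj => [|l] ls lj; first exact: (ge_nth st (leq0n j)).
  case: j lj jt => [|j] lj jt; first by move: lj; rewrite /=; lia.
  apply: (IHt s l j) => //; first exact: path_sorted st.
  by move: lj jt; rewrite /= subSS addSn !ltnS => -> ->.
- have := size_subseq sub; rewrite /= => sst.
  case: j lj jt => [|j] lj jt; first by move: lj; rewrite /=; lia.
  apply: (IHt (x :: s) l j) => //; first exact: path_sorted st.
  by move: lj jt sst ls => /=; lia.
Qed.

End sorted_subseq.

Lemma sum_take_drop (R : realType) (I : Type) (F : I -> R) (s : seq I) i n :
  (i + n <= size s)%N ->
  \sum_(x <- take n (drop i s)) F x =
  \sum_(i <= l < i + n) nth 0 (map F s) l.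
Proof.
move=> ins; rewrite -(big_map F xpredT id) (big_nth 0) size_map size_takel; last first.
  by rewrite size_drop; lia.
rewrite -{2}[i]add0n big_addn addKn [in LHS]big_nat [in RHS]big_nat.
apply: eq_bigr => j /= jn.
by rewrite map_take map_drop nth_take// nth_drop addnC.
Qed.

Lemma count_mem_uniq (T : finType) (A : {set T}) (s : seq T) : uniq s ->
  (count (mem A) s <= #|A|)%N.
Proof.
move=> us; rewrite -size_filter cardE; apply: uniq_leq_size.
  exact: filter_uniq.
by move=> i; rewrite mem_filter mem_enum => /andP[].
Qed.

(** * Certified overlap of the smoothed prediction with [L] *)

Theorem theorem1 (R : realType) (m c : nat) (f : m.-tuple R -> {set 'I_c})
    (kp k : nat) (sigma : R) (x : m.-tuple R) (L : {set 'I_c})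
    (plo pup : 'I_c -> R) (a b : seq 'I_c) (rad : R) :
  (1 <= c)%N ->
  (forall i : 'I_c, measurable [set w : m.-tuple R | i \in f w]) ->
  (forall w, #|f w| = kp) ->
  (1 <= kp <= c)%N -> (1 <= k <= c)%N -> 0 < sigma ->
  (1 <= #|L|)%N ->
  (forall i, i \in L -> 0 <= plo i <= 1 /\ plo i <= label_prob sigma f x i) ->
  (forall j, j \notin L -> 0 <= pup j <= 1 /\ label_prob sigma f x j <= pup j) ->
  perm_eq a (enum L) -> sorted (fun i j => plo j <= plo i) a ->
  perm_eq b (enum (~: L)) -> sorted (fun i j => pup j <= pup i) b ->
  let pa := fun l : nat => nth 0 (map plo a) l.-1 in
  let pb := fun l : nat => nth 0 (map pup b) l.-1 in
  (forall e' : nat, (1 <= e' <= minn #|L| k)%N ->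
     forall v : nat, (1 <= v <= (k - e').+1)%N -> pB k pb e' v <= kp%:R) ->
  0 <= rad ->
  forall delta : m.-tuple R, norm2 delta <= rad ->
  forall G : {set 'I_c}, is_topk (label_prob sigma f (vadd x delta)) k G ->
  (cert_e sigma rad kp k #|L| pa pb <= #|L :&: G|)%N.
Proof.
move=> _ mf fkp /andP[kp0 _] _ sigma_gt0 _ Hlo Hup aL sa bL sb pa pb _ rad0
  delta drad G [cG topG].
(* [cert_e] is a maximum, so it suffices to bound each certified [e']. Fewer than [e'] common labels
   will contradict its certificate. *)
apply/bigmax_leqP_seq => e'; rewrite mem_index_iota ltnS leq_min.
move=> /andP[e'0 /andP[e'd e'k]] cert; rewrite leqNgt; apply/negP => Glt.
set z := vadd x delta in topG *.
pose P := label_prob sigma f z.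
have dr : norm2 delta / sigma <= rad / sigma by rewrite ler_pM2r ?invr_gt0.
pose A := [seq i <- a | i \notin G].
pose B := [seq i <- b | i \in G].
have uA : uniq A by rewrite filter_uniq// (perm_uniq aL) enum_uniq.
have uB : uniq B by rewrite filter_uniq// (perm_uniq bL) enum_uniq.
have memA i : (i \in A) = (i \notin G) && (i \in L).
  by rewrite mem_filter (perm_mem aL) mem_enum.
have memB i : (i \in B) = (i \in G) && (i \notin L).
  by rewrite mem_filter (perm_mem bL) mem_enum inE.
have sza : size a = #|L| by rewrite (perm_size aL) -cardE.
have szA : (size A + #|L :&: G| = #|L|)%N.
  rewrite -(cardsID G L) addnC -(card_uniqP uA); congr (_ + _)%N.
  by apply: eq_card => i; rewrite memA !inE.
have szB : (size B + #|L :&: G| = k)%N.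
  rewrite -cG -(cardsID L G) addnC finset.setIC -(card_uniqP uB); congr (_ + _)%N.
  by apply: eq_card => i; rewrite memB !inE andbC.
have ltA : (#|L| - e' < size A)%N by move: szA Glt e'd; clear; lia.
have ltB : (k - e' < size B)%N by move: szB Glt e'k; clear; lia.
have A0 : (0 < size A)%N by apply: leq_trans ltA.
(* [P i0] is the value that will separate the two sides of the certificate. *)
have [i0 i0A maxP] : exists2 i0, i0 \in A & forall i, i \in A -> P i <= P i0.
  have [i1 i1A] : exists i, i \in A.
    by case: (A) A0 => // i s _; exists i; rewrite mem_head.
  by case: (@Order.TotalTheory.arg_maxP _ _ _ i1 (mem A) P i1A) => i iA iP; exists i.
have minP j : j \in B -> P i0 <= P j.
  by rewrite memB => /andP[jG _]; apply: topG => //; move: i0A; rewrite memA => /andP[].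
have sorted_map (v : 'I_c -> R) s : sorted (fun i j => v j <= v i) s ->
    sorted (fun x y : R => y <= x) (map v s) by rewrite sorted_map.
have lbA u N : (1 <= u <= (#|L| - e').+1)%N -> (0 < N)%N ->
    (forall w, (count (mem (f w)) (take u (drop 0 A)) <= N)%N) ->
    N%:R / u%:R * PhiE (PhiInv (pA pa e' u / N%:R) - (rad / sigma)%:E)%E <= P i0.
  move=> /andP[u0 uL] N0 cN.
  have uA' : (0 + u <= size A)%N by exact: leq_trans ltA.
  have le1 : pA pa e' u <=
      \sum_(i <- take u (drop 0 A)) label_prob sigma f x i.
    apply: (@le_trans _ _ (\sum_(i <- take u (drop 0 A)) plo i)).
      rewrite sum_take_drop// /pA -{1}[e']add0n big_addn addKn add0n.
      apply: ler_sum_nat => j /andP[_ ju].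
      (* At most [e' - 1] labels of [L] lie in [G], so the label at index [j] of [A] has index at
         most [j + e' - 1] in [a], which is the index read by [pa (j + e')]. *)
      apply: nth_subseq_ge.
      - exact: sorted_map.
      - by apply: map_subseq; exact: filter_subseq.
      - by rewrite size_map; exact: leq_trans ju uA'.
      - rewrite !size_map sza; move: szA Glt e'd ju uL e'0; clear; lia.
    rewrite big_seq [leRHS]big_seq; apply: ler_sum => i /mem_take/mem_drop.
    by rewrite memA => /andP[_ /Hlo[]].
  (* The sum of [u] shifted probabilities is at most [u * P i0]; this accounts for the factor
     [N / u]. *)
  have := sum_label_prob_shift_lb sigma_gt0 mf N0 cN dr le1.
  rewrite mulrAC ler_pdivrMr ?ltr0n// => /le_trans; apply.
  rewrite (@le_trans _ _ (\sum_(i <- take u (drop 0 A)) P i0))//.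
    rewrite big_seq [leRHS]big_seq; apply: ler_sum => i /mem_take/mem_drop.
    exact: maxP.
  by rewrite big_const_seq count_predT size_takel ?drop0// iter_addr_0 mulr_natr.
(* With [s = (k - e').+1], the window holds indices [s - v] to [s - 1] of [B]; counted from 1, as in
   [pB], these are [s - v + 1] to [s]. *)
have ubB v N : (1 <= v <= (k - e').+1)%N -> (0 < N)%N ->
    (forall w, (count (mem (f w)) (take v (drop ((k - e').+1 - v) B)) <= N)%N) ->
    P i0 <= N%:R / v%:R * PhiE (PhiInv (pB k pb e' v / N%:R) + (rad / sigma)%:E)%E.
  move=> /andP[v0 vk] N0 cN.
  have vB : ((k - e').+1 - v + v <= size B)%N by rewrite subnK.
  have le1 : \sum_(i <- take v (drop ((k - e').+1 - v) B)) label_prob sigma f x i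
      <= pB k pb e' v.
    apply: (@le_trans _ _ (\sum_(i <- take v (drop ((k - e').+1 - v) B)) pup i)).
      rewrite big_seq [leRHS]big_seq; apply: ler_sum => i /mem_take/mem_drop.
      by rewrite memB => /andP[_ /Hup[]].
    rewrite sum_take_drop// /pB big_add1 subnK//=.
    apply: ler_sum_nat => j /andP[_ jk].
    apply: nth_subseq_le.
    - exact: sorted_map.
    - by apply: map_subseq; exact: filter_subseq.
    - by rewrite size_map (leq_trans jk).
  have := sum_label_prob_shift_ub sigma_gt0 mf N0 cN dr le1.
  rewrite mulrAC ler_pdivlMr ?ltr0n//; apply: le_trans.
  rewrite (@le_trans _ _ (\sum_(i <- take v (drop ((k - e').+1 - v) B)) P i0))//.
    rewrite big_const_seq count_predT size_takel ?iter_addr_0 ?mulr_natr//.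
    by rewrite size_drop leq_subRL (leq_trans (leq_addr _ _) vB, vB).
  rewrite big_seq [leRHS]big_seq; apply: ler_sum => i /mem_take/mem_drop.
  exact: minP.
have uniq_count s w : uniq s -> (count (mem (f w)) s <= kp)%N.
  by move=> us; rewrite -(fkp w); exact: count_mem_uniq.
move: cert; rewrite /cert_cond ltNge => /negP; apply.
apply: (@le_trans _ _ (P i0)).
(* The starting value of the iterated maximum is the single-label term, obtained with [u = N = 1];
   the other terms have [N = kp]. The minimum below is treated alike. *)
- rewrite big_nat; apply: bigmax_le => [|u /andP[u1 u2]].
    have := @lbA 1%N 1%N isT isT; rewrite /pA addn1 big_nat1 !divr1 mul1r; apply.
    by move=> w; rewrite (leq_trans (count_size _ _))// size_take_min geq_minl.
  apply: lbA => //; first by rewrite u1.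
  by move=> w; apply: uniq_count; rewrite take_uniq// drop_uniq.
- rewrite big_nat; apply: le_bigmin => [|v /andP[v1 v2]].
    have := @ubB 1%N 1%N isT isT.
    rewrite /pB subn1/= big_nat1 !divr1 mul1r; apply.
    by move=> w; rewrite (leq_trans (count_size _ _))// size_take_min geq_minl.
  apply: ubB => //; first by rewrite v1.
  by move=> w; apply: uniq_count; rewrite take_uniq// drop_uniq.
Qed.
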